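(* Let $A,B\in\mathcal{M}_n^+$ with $B\le A$ and let $0\le v\le 1$. Then $$\frac{v(1-v)}{2}(A-B)A^{-1}(A!B)A^{-1}(A-B)\;\le\; A\nabla_v B-A\sharp_v B\;\le\;\frac{v(1-v)}{2}(A-B)B^{-1}(A-B).$$
   Context: $\mathcal{M}_n^+$ denotes the set of positive (definite) $n\times n$ complex matrices: $A\in\mathcal{M}_n^+$ iff $\langle Ax,x\rangle>0$ for all nonzero $x\in\mathbb{C}^n$. For Hermitian matrices, $X\le Y$ means that $Y-X$ is positive semidefinite. For $A,B\in\mathcal{M}_n^+$ and $0\le v\le1$, $A\nabla_v B=(1-v)A+vB$ is the weighted arithmetic mean, $A\sharp_v B=A^{1/2}\left(A^{-1/2}BA^{-1/2}\right)^{v}A^{1/2}$ is the weighted geometric mean, and $A!B=\left(\frac{A^{-1}+B^{-1}}{2}\right)^{-1}$ is the harmonic mean. *)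

(* Defs.v *)
From mathcomp Require Import all_boot all_order all_algebra.
From mathcomp Require Import complex.
From mathcomp Require Import reals exp.

Set Implicit Arguments.
Unset Strict Implicit.
Unset Printing Implicit Defensive.

Import Order.TTheory GRing.Theory Num.Theory.

Local Open Scope ring_scope.
Local Open Scope complex_scope.
Local Open Scope sesquilinear_scope.

Section MatrixMeans.
Context {R : realType} {n : nat}.
Implicit Types (A B X Y : 'M[R[i]]_n) (x y : 'cV[R[i]]_n) (v t : R).

(* The standard inner product of C^n, conjugate-linear in the second
   argument. *)
Definition inner x y : R[i] := (y ^t* *m x) 0 0.

(* In R[i], [0 < z] and [0 <= z] entail that z is real, so these two
   predicates force A to be Hermitian. *)
Definition posdefmx A : Prop := forall x, x != 0 -> 0 < inner (A *m x) x.

Definition possemidefmx A : Prop := forall x, 0 <= inner (A *m x) x.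

Definition loewner_le X Y : Prop := possemidefmx (Y - X).

(* Functional calculus a |-> a `^ t through the unitary diagonalization
   A = U^-1 diag(d) U given by the spectral theorem (orthomx_spectralP).
   Meaningful for A positive definite: the eigenvalues d_i are then positive
   reals, so that Re only changes their type. *)
Definition powmx A t : 'M[R[i]]_n :=
  invmx (spectralmx A)
  *m diag_mx (map_mx (fun d : R[i] => (powR (complex.Re d) t)%:C)
                     (spectral_diag A))
  *m spectralmx A.

Definition arithmean v A B : 'M[R[i]]_n := (1 - v)%:C *: A + v%:C *: B.

Definition geomean v A B : 'M[R[i]]_n :=
  powmx A (2^-1)
  *m powmx (powmx A (- 2^-1) *m B *m powmx A (- 2^-1)) v
  *m powmx A (2^-1).

Definition harmmean A B : 'M[R[i]]_n :=
  invmx (2^-1 *: (invmx A + invmx B)).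

End MatrixMeans.

(* Main.v *)
(* Writing C = A^(-1/2) B A^(-1/2) = U^* diag(c) U with U unitary, the matrix
   G = U A^(1/2) satisfies A = G^* G and B = G^* diag(c) G, and both
   sides of each inequality take the form G^* f(diag(c)) G with f scalar.  As
   B <= A forces 0 < c_i <= 1, it suffices to prove for 0 < x <= 1 that
     v(1-v)/2 (1-x)^2 <= 1 - v + v x - x^v <= v(1-v)/2 (1-x)^2 / x;
   the paper's lower bound has the extra factor 2x/(1+x) <= 1.  With
   x = exp(-s) the differences vanish at s = 0 and have nonnegative
   derivatives, by the tangent line inequality for exp and its convexity. *)
Require Import Defs.
From mathcomp Require Import all_boot all_order all_algebra.
From mathcomp Require Import complex.
From mathcomp Require Import topology normedtype sequences realfun derive.
From mathcomp Require Import reals exp.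
From mathcomp Require Import ring lra.

Import Order.TTheory GRing.Theory Num.Theory.
Import numFieldNormedType.Exports.

Local Open Scope ring_scope.
Local Open Scope complex_scope.
Local Open Scope sesquilinear_scope.

(** * Scalar bounds for the gap between weighted means *)

Lemma ge0_of_derive_ge0 (R : realType) (f df : R -> R) (s : R) :
  0 <= s -> (forall t, is_derive t (1 : R) f (df t)) ->
  (forall t, 0 <= t -> 0 <= df t) -> f 0 = 0 -> 0 <= f s.
Proof.
move=> s0 dfE df0 f0.
have [|c] := @MVT_segment R f df 0 s s0 (fun x _ => dfE x).
  apply: derivable_within_continuous => x _.
  by have [] := dfE x.
rewrite in_itv /= f0 !subr0 => /andP[c0 _] ->.
by rewrite mulr_ge0 ?df0.
Qed.

(** The graph of exp lies above its tangent line at [w * s]. Averaging this at the points [s] and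
    [0] with weights [w] and [1 - w] cancels the linear terms. *)
Lemma expR_convex (R : realType) (w s : R) :
  0 <= w <= 1 -> expR (w * s) <= 1 - w + w * expR s.
Proof.
move=> /andP[w0 w1].
have h1 := expR_ge1Dx ((1 - w) * s); have h2 := expR_ge1Dx (- (w * s)).
have e1 : expR s = expR (w * s) * expR ((1 - w) * s).
  by rewrite -expRD; congr expR; ring.
have e2 : expR (w * s) * expR (- (w * s)) = 1 by rewrite expRxMexpNx_1.
rewrite e1; have p := expR_gt0 (w * s).
set E := expR (w * s) in e1 e2 p *; set F := expR ((1 - w) * s) in e1 h1 *.
have w1F : 0 <= w * (F - (1 + (1 - w) * s)) by rewrite mulr_ge0 ?subr_ge0.
have w1N : 0 <= (1 - w) * (expR (- (w * s)) - (1 - w * s)).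
  by rewrite mulr_ge0 ?subr_ge0.
have := mulr_ge0 (ltW p) (addr_ge0 w1F w1N); nra.
Qed.

Lemma is_derive_expRM (R : realType) (a t : R) :
  is_derive t (1 : R) (fun s => expR (a * s)) (a * expR (a * t)).
Proof.
have -> : (fun s => expR (a * s)) = expR \o ( *%R a) by [].
rewrite mulrC; apply: is_derive1_comp.
have := @is_deriveZ R R R id a t 1 1 (is_derive_id t 1).
by rewrite [a *: 1]mulr1.
Qed.

Section ScalarBounds.
Context {R : realType} (v : R) (hv : 0 <= v <= 1).

Lemma exp_mean_gap_lower (s : R) : 0 <= s ->
  v * (1 - v) / 2 * (1 - expR (- s)) ^+ 2
  <= 1 - v + v * expR (- s) - expR (- (v * s)).
Proof.
move=> s0; have /andP[v0 v1] := hv.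
(* The square is expanded so that each nonconstant term is a multiple of some [expR (a * t)], the
   shape that [is_derive_expRM] differentiates. *)
pose f := fun t : R => 1 - v - v * (1 - v) / 2
  + (v + v * (1 - v)) * expR (-1 * t)
  - expR (- v * t) - v * (1 - v) / 2 * expR (-2 * t).
pose df := fun t : R =>
  (v + v * (1 - v)) * (-1 * expR (-1 * t))
  - (- v) * expR (- v * t) - v * (1 - v) / 2 * (-2 * expR (-2 * t)).
have sqE (t : R) : expR (-2 * t) = expR (-1 * t) ^+ 2.
  by rewrite expr2 -expRD; congr expR; ring.
have : 0 <= f s.
  apply: (@ge0_of_derive_ge0 R f df) => // [t|t t0|].
  - have d1 := is_derive_expRM R (-1) t.
    have d2 := is_derive_expRM R (-v) t.
    have d3 := is_derive_expRM R (-2) t.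
    by apply: is_derive_eq; rewrite /df /GRing.scale /=; ring.
  - have h1 := expR_ge1Dx ((1 - v) * t); have h2 := expR_ge1Dx (-1 * t).
    rewrite /df sqE.
    have -> : expR (- v * t) = expR (-1 * t) * expR ((1 - v) * t).
      by rewrite -expRD; congr expR; ring.
    set e := expR (-1 * t) in h2 *; set E := expR _ in h1 *.
    (* The last factor is nonnegative because [E - 1 >= (1 - v) * t] and [t >= 1 - e]. *)
    rewrite (_ : _ - _ = v * e * (E - 1 - (1 - v) * (1 - e))); last by field.
    have e0 : 0 < e by exact: expR_gt0.
    by rewrite !mulr_ge0 ?(ltW e0)//; nra.
  - by rewrite /f !mulr0 expR0; field.
rewrite /f sqE mulN1r mulNr; lra.
Qed.

(** With [x = expR (- s)], the bracket on the right is [(1 - x) ^+ 2 / x]. *)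
Lemma exp_mean_gap_upper (s : R) : 0 <= s ->
  1 - v + v * expR (- s) - expR (- (v * s))
  <= v * (1 - v) / 2 * (expR s - 2 + expR (- s)).
Proof.
move=> s0; have /andP[v0 v1] := hv.
pose f := fun t : R => v * (1 - v) / 2 * expR (1 * t)
  - (1 - v + v * (1 - v))
  + (v * (1 - v) / 2 - v) * expR (-1 * t) + expR (- v * t).
pose df := fun t : R => v * (1 - v) / 2 * (1 * expR (1 * t))
  + (v * (1 - v) / 2 - v) * (-1 * expR (-1 * t)) + (- v) * expR (- v * t).
have : 0 <= f s.
  apply: (@ge0_of_derive_ge0 R f df) => // [t|t t0|].
  - have d1 := is_derive_expRM R 1 t.
    have d2 := is_derive_expRM R (-v) t.
    have d3 := is_derive_expRM R (-1) t.
    by apply: is_derive_eq; rewrite /df /GRing.scale /=; ring.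
  - have hw : 0 <= 1 - v <= 1 by lra.
    have h1 := expR_convex R _ t hw.
    rewrite /df !mul1r.
    have -> : expR (- v * t) = expR (-1 * t) * expR ((1 - v) * t).
      by rewrite -expRD; congr expR; ring.
    have e1 : expR (-1 * t) * expR t = 1 by rewrite mulN1r mulrC expRxMexpNx_1.
    have y1 := expR_ge1Dx t.
    have e0 : 0 < expR (-1 * t) by exact: expR_gt0.
    set e := expR (-1 * t) in e0 e1 *; set E := expR (_ * t) in h1 *.
    set y := expR t in e1 h1 y1 *.
    (* Convexity gives [E <= v + (1 - v) * y], so the last factor of the derivative, as rewritten
       below, is at least half of this quantity. *)
    have w0 : 0 <= (1 - v) * (y - 1) ^+ 2.
      by rewrite mulr_ge0 ?sqr_ge0 ?subr_ge0.
    rewrite (_ : _ + _ = v * e * ((1 - v) / 2 * (y ^+ 2 - 1) + 1 - E));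
      last first.
      (* The product [e * y] is isolated so that [e1] can replace it by 1 before [field] closes the
         identity. *)
      have -> : v * e * ((1 - v) / 2 * (y ^+ 2 - 1) + 1 - E) =
        v * (1 - v) / 2 * (e * y) * y - v * e * ((1 - v) / 2) + v * e * (1 - E).
        by field.
      by rewrite e1; field.
    by rewrite !mulr_ge0 ?(ltW e0)//; lra.
  - by rewrite /f !mulr0 expR0; field.
rewrite /f mulN1r mul1r mulNr; lra.
Qed.

Lemma powR_mean_gap (x : R) : 0 < x -> x <= 1 ->
  v * (1 - v) / 2 * (1 - x) ^+ 2 <= 1 - v + v * x - x `^ v
  <= v * (1 - v) / 2 * ((1 - x) ^+ 2 / x).
Proof.
move=> x0 x1.
have s0 : 0 <= - ln x by rewrite oppr_ge0 ln_le0.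
have := exp_mean_gap_upper _ s0; have := exp_mean_gap_lower _ s0.
rewrite !mulrN !opprK expRN lnK ?posrE// /powR gt_eqF// => -> /=.
congr (_ <= _); congr (_ * _).
by field; rewrite gt_eqF.
Qed.

End ScalarBounds.

(** * Inverses of products and of sums of inverses *)

Lemma mulmx1_invmx (K : comUnitRingType) m (X Y : 'M[K]_m) :
  X *m Y = 1%:M -> invmx Y = X.
Proof.
move=> XY; have [_ uY] := mulmx1_unit XY.
by rewrite -[RHS](mulmxK uY) XY mul1mx.
Qed.

(** The common right factor [Y] cancels, so a quotient of two matrices of the form [X *m _ *m Y] is
    a conjugate by [X]. *)
Lemma mulmx_invmx_conj (K : comUnitRingType) m (X Y D E F : 'M[K]_m) :
  X \in unitmx -> Y \in unitmx -> E *m F = 1%:M ->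
  X *m D *m Y *m invmx (X *m E *m Y) = X *m (D *m F) *m invmx X.
Proof.
move=> uX uY eEF; have [uE _] := mulmx1_unit eEF.
have uK : X *m E *m Y \in unitmx by rewrite !unitmx_mul uX uY uE.
apply: (canLR (mulmxK uK)); rewrite !mulmxA mulmxKV //.
by rewrite -[X in _ = X *m Y]mulmxA (mulmx1C eEF) mulmx1.
Qed.

(** Serves to certify [H] as the harmonic mean of [A] and [B]: both quotients are conjugates by the
    same [X], so their sum is computed on the middle factors. *)
Lemma mulmx_invmx_sum (K : comUnitRingType) m k (X A B H D E : 'M[K]_m) :
  X \in unitmx -> H *m invmx A = X *m D *m invmx X ->
  H *m invmx B = X *m E *m invmx X -> k *: (D + E) = 1%:M ->
  H *m (k *: (invmx A + invmx B)) = 1%:M.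
Proof.
move=> uX eA eB eDE.
rewrite -scalemxAr mulmxDr eA eB -mulmxDl -mulmxDr.
by rewrite -(mulmxV uX) scalemxAl scalemxAr eDE mulmx1.
Qed.

(** * Hermitian forms and positivity under congruence *)

Section Hermitian.
Context {R : realType} {n : nat}.
Implicit Types (A B G X : 'M[R[i]]_n) (x y : 'cV[R[i]]_n).

Lemma trmxC_mul m p q (A : 'M[R[i]]_(m, p)) (B : 'M[R[i]]_(p, q)) :
  (A *m B)^t* = B^t* *m A^t*.
Proof. by rewrite trmx_mul map_mxM. Qed.

Lemma inner_congr A G x :
  inner (G^t* *m A *m G *m x) x = inner (A *m (G *m x)) (G *m x).
Proof. by rewrite /inner trmxC_mul !mulmxA. Qed.

Lemma inner_trmxC A x : inner (A^t* *m x) x = Num.conj (inner (A *m x) x).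
Proof.
rewrite /inner; set y := x^t* *m _; set z := _ *m _.
have -> : y = z^t* by rewrite /y /z !trmxC_mul trmxCK mulmxA.
by rewrite !mxE.
Qed.

(** Polarization: evaluating the form at [x + y] and at [x + 'i *: y] shows that [b x y] and [b y x]
    are both opposite and equal, hence zero. Basis vectors then read off the entries of [A]. *)
Lemma inner_eq0 A : (forall x, inner (A *m x) x = 0) -> A = 0.
Proof.
move=> A0.
pose b x y := (y^t* *m (A *m x)) 0 0.
have bDl x y z : b (x + y) z = b x z + b y z.
  by rewrite /b !mulmxDr mxE.
have bDr x y z : b x (y + z) = b x y + b x z.
  by rewrite /b linearD map_mxD mulmxDl mxE.
have bZl k x y : b (k *: x) y = k * b x y.
  by rewrite /b -!scalemxAr mxE.
have bZr k x y : b x (k *: y) = Num.conj k * b x y.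
  by rewrite /b linearZ map_mxZ -scalemxAl mxE.
have b0 x y : b x y = 0.
  have b0 z : b z z = 0 := A0 z.
  have := b0 (x + y); have := b0 (x + 'i%R *: y).
  rewrite !bDl !bDr !bZl !bZr !b0.
  rewrite conjCi !mulr0 !add0r !addr0 mulNr addrC => /eqP.
  rewrite subr_eq0 => /eqP/(mulfI (neq0Ci _)) ->.
  by rewrite -mulr2n => /eqP; rewrite mulrn_eq0 => /eqP.
apply/matrixP => i j; rewrite mxE.
have := b0 (delta_mx j 0) (delta_mx i 0).
by rewrite /b trmx_delta map_delta_mx -colE -rowE !mxE.
Qed.

(** The values of the quadratic form are real, so the form of [A^t* - A] vanishes. *)
Lemma possemidefmx_hermitian A : possemidefmx A -> A^t* = A.
Proof.
move=> hA; apply/eqP; rewrite -subr_eq0; apply/eqP/inner_eq0 => x.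
have eA := inner_trmxC A x; rewrite (geC0_conj (hA x)) in eA.
by move: eA; rewrite /inner mulmxBl mulmxBr !mxE => ->; rewrite subrr.
Qed.

Lemma posdefmx_semi A : posdefmx A -> possemidefmx A.
Proof.
move=> hA x; have [->|/hA/ltW//] := eqVneq x 0.
by rewrite /inner !mulmx0 mxE.
Qed.

Lemma diag_congr_possemidef (G : 'M[R[i]]_n) (d : 'rV[R[i]]_n) :
  (forall i, 0 <= d 0 i) -> possemidefmx (G^t* *m diag_mx d *m G).
Proof.
move=> d0 x; rewrite inner_congr; set y := G *m x.
rewrite /inner mulmxA mul_mx_diag mxE.
rewrite sumr_ge0 // => i _; rewrite !mxE mulrAC mulr_ge0 ?d0//.
by rewrite mulrC mul_conjC_ge0.
Qed.

(** This test vector, sent by [G] to a basis vector, recovers the signs of [d] from the congruence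
    even when [G] is not unitary. *)
Lemma inner_diag_congr G (d : 'rV[R[i]]_n) i :
  G \in unitmx -> let x := invmx G *m delta_mx i 0 in
  inner (G^t* *m diag_mx d *m G *m x) x = d 0 i.
Proof.
move=> uG; rewrite /= inner_congr mulKVmx // /inner.
by rewrite trmx_delta map_delta_mx mulmxA -rowE -colE !mxE eqxx mulr1n.
Qed.

Lemma possemidef_diag_congr G (d : 'rV[R[i]]_n) :
  G \in unitmx -> possemidefmx (G^t* *m diag_mx d *m G) -> forall i, 0 <= d 0 i.
Proof. by move=> uG hd i; rewrite -(inner_diag_congr G d i uG). Qed.

Lemma posdef_diag_congr G (d : 'rV[R[i]]_n) :
  G \in unitmx -> posdefmx (G^t* *m diag_mx d *m G) -> forall i, 0 < d 0 i.
Proof.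
move=> uG hd i; rewrite -(inner_diag_congr G d i uG); apply: hd.
apply: contraTneq (oner_neq0 R[i]) => /(congr1 (mulmx G)).
rewrite mulKVmx // mulmx0 => /matrixP/(_ i 0).
by rewrite !mxE !eqxx negbK => /eqP.
Qed.

Lemma posdefmx_congr A G : G \in unitmx -> posdefmx A ->
  posdefmx (G^t* *m A *m G).
Proof.
move=> uG hA x x0; rewrite inner_congr; apply: hA.
by apply: contra_neq x0 => Gx0; rewrite -(mulKmx uG x) Gx0 mulmx0.
Qed.

(** * Real functions of a diagonal matrix, carried by a congruence *)

Definition fun_diag (c : 'rV[R]_n) (f : R -> R) : 'M[R[i]]_n :=
  diag_mx (map_mx (fun r => (f r)%:C) c).

(** For unitary [G] this is the functional calculus. For a general [G] it is still linear in [f],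
    and pointwise nonnegativity of [f] on [c] still gives a positive semidefinite matrix. *)
Definition fun_congr G (c : 'rV[R]_n) (f : R -> R) : 'M[R[i]]_n :=
  G^t* *m fun_diag c f *m G.

(** [A] is Hermitian, hence normal, so the spectral theorem applies. The diagonal entries are
    positive in [R[i]], hence real, and taking [Re] loses nothing. *)
Lemma posdefmx_spectral A : posdefmx A ->
  exists P : 'M[R[i]]_n, exists a : 'rV[R]_n,
  [/\ P \is unitarymx, forall i, 0 < a 0 i, A = fun_congr P a id
    & forall t, powmx A t = fun_congr P a (fun r => r `^ t)].
Proof.
move=> hA; pose P := spectralmx A; pose d := spectral_diag A.
have uP : P \is unitarymx := spectral_unitarymx A.
have eA : A = P^t* *m diag_mx d *m P.
  rewrite -invmx_unitary //; apply/orthomx_spectralP/normalmxP.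
  by rewrite (possemidefmx_hermitian _ (posdefmx_semi _ hA)).
have d0 i : 0 < d 0 i.
  by apply: (posdef_diag_congr P) (unitarymx_unit uP) _ i; rewrite -eA.
exists P, (map_mx (@complex.Re R) d); split; [by []|move=> i| |move=> t].
- by rewrite mxE; have := d0 i; rewrite ltcE => /andP[].
- suff -> : fun_congr P (map_mx (@complex.Re R) d) id = P^t* *m diag_mx d *m P.
    exact: eA.
  rewrite /fun_congr.
  suff -> : fun_diag (map_mx (@complex.Re R) d) id = diag_mx d by [].
  rewrite /fun_diag; congr diag_mx.
  by apply/rowP => i; rewrite !mxE RRe_real // realE ltW.
- have eD : fun_diag (map_mx (@complex.Re R) d) (fun r => r `^ t)
           = diag_mx (map_mx (fun z => (complex.Re z `^ t)%:C) d).
    by rewrite /fun_diag -map_mx_comp.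
  by rewrite /fun_congr eD -(invmx_unitary uP).
Qed.

Section FunCongr.
Context (G : 'M[R[i]]_n) (c : 'rV[R]_n).
Implicit Types (f g h : R -> R) (k : R).

Lemma eq_fun_diag f g :
  (forall i, f (c 0 i) = g (c 0 i)) -> fun_diag c f = fun_diag c g.
Proof.
by move=> fg; congr diag_mx; apply/rowP => i; rewrite !mxE fg.
Qed.

Lemma fun_diagM f g :
  fun_diag c f *m fun_diag c g = fun_diag c (fun r => f r * g r).
Proof.
rewrite /fun_diag mulmx_diag; congr diag_mx.
by apply/rowP => i; rewrite !mxE rmorphM.
Qed.

Lemma fun_diag1 : fun_diag c (fun=> 1) = 1%:M.
Proof.
rewrite /fun_diag -diag_const_mx; congr diag_mx.
by apply/rowP => i; rewrite !mxE.
Qed.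

Lemma trmxC_fun_congr f : (fun_congr G c f)^t* = fun_congr G c f.
Proof.
have eD : (fun_diag c f)^t* = fun_diag c f.
  rewrite /fun_diag tr_diag_mx map_diag_mx; congr diag_mx.
  by apply/rowP => i; rewrite !mxE; apply: conj_Creal; rewrite complex_real.
by rewrite /fun_congr !trmxC_mul trmxCK eD mulmxA.
Qed.

Lemma eq_fun_congr f g :
  (forall i, f (c 0 i) = g (c 0 i)) -> fun_congr G c f = fun_congr G c g.
Proof. by rewrite /fun_congr => /eq_fun_diag->. Qed.

Lemma fun_congrB f g :
  fun_congr G c f - fun_congr G c g = fun_congr G c (fun r => f r - g r).
Proof.
have eD : fun_diag c (fun r => f r - g r) = fun_diag c f - fun_diag c g.
  by apply/matrixP => i j; rewrite !mxE rmorphB mulrnBl.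
by rewrite /fun_congr eD mulmxBr mulmxBl.
Qed.

Lemma fun_congrD f g :
  fun_congr G c f + fun_congr G c g = fun_congr G c (fun r => f r + g r).
Proof.
have eD : fun_diag c (fun r => f r + g r) = fun_diag c f + fun_diag c g.
  by apply/matrixP => i j; rewrite !mxE rmorphD mulrnDl.
by rewrite /fun_congr eD mulmxDr mulmxDl.
Qed.

Lemma fun_congrZ k f :
  k%:C *: fun_congr G c f = fun_congr G c (fun r => k * f r).
Proof.
have eD : fun_diag c (fun r => k * f r) = k%:C *: fun_diag c f.
  by apply/matrixP => i j; rewrite !mxE rmorphM mulrnAr.
by rewrite /fun_congr eD -scalemxAr -scalemxAl.
Qed.

Lemma fun_congr_possemidef f :
  (forall i, 0 <= f (c 0 i)) -> possemidefmx (fun_congr G c f).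
Proof.
by move=> f0; apply: diag_congr_possemidef => i; rewrite mxE ler0c.
Qed.

Lemma possemidef_fun_congr f : G \in unitmx ->
  possemidefmx (fun_congr G c f) -> forall i, 0 <= f (c 0 i).
Proof.
move=> uG hf i; have := possemidef_diag_congr _ _ uG hf i.
by rewrite mxE ler0c.
Qed.

Lemma mul_fun_congr_unitary f g : G \is unitarymx ->
  fun_congr G c f *m fun_congr G c g = fun_congr G c (fun r => f r * g r).
Proof.
by move=> uG; rewrite /fun_congr -fun_diagM !mulmxA mulmxtVK.
Qed.

Context (uG : G \in unitmx).

Lemma fun_congr_mul_invmx f g : (forall i, g (c 0 i) != 0) ->
  fun_congr G c f *m invmx (fun_congr G c g)
  = G^t* *m fun_diag c (fun r => f r / g r) *m invmx (G^t*).
Proof.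
move=> g0; have uG' : G^t* \in unitmx by rewrite map_unitmx unitmx_tr.
have eD : fun_diag c g *m fun_diag c (fun r => (g r)^-1) = 1%:M.
  rewrite fun_diagM -fun_diag1; apply: eq_fun_diag => i.
  by rewrite divff.
by rewrite /fun_congr (mulmx_invmx_conj _ _ _ _ _ _ _ uG' uG eD) fun_diagM.
Qed.

(** Inverting the middle factor makes [G] cancel on its left and [G^t*] on its right, so such triple
    products are computed pointwise although [G] need not be unitary. *)
Lemma fun_congr_mul_invmx_mul f g h : (forall i, g (c 0 i) != 0) ->
  fun_congr G c f *m invmx (fun_congr G c g) *m fun_congr G c h
  = fun_congr G c (fun r => f r / g r * h r).
Proof.
move=> g0; rewrite fun_congr_mul_invmx // /fun_congr !mulmxA mulmxKV.
  by rewrite -[X in X *m G]mulmxA fun_diagM.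
by rewrite map_unitmx unitmx_tr.
Qed.

(** Pointwise, [h] is the harmonic mean of [f] and [g], so [h / f + h / g = 2]. This identifies the
    inverse without computing it. *)
Lemma harmmean_fun_congr f g :
  (forall i, 0 < f (c 0 i)) -> (forall i, 0 < g (c 0 i)) ->
  harmmean (fun_congr G c f) (fun_congr G c g)
  = fun_congr G c (fun r => 2 * f r * g r / (f r + g r)).
Proof.
move=> f0 g0; set h := fun r => 2 * f r * g r / (f r + g r).
have uG' : G^t* \in unitmx by rewrite map_unitmx unitmx_tr.
have eD : 2^-1 *: (fun_diag c (fun r => h r / f r)
                   + fun_diag c (fun r => h r / g r)) = 1%:M.
  rewrite -fun_diag1; apply/matrixP => i j; rewrite !mxE -mulrnDl mulrnAr.
  rewrite -rmorphD -(rmorph_nat (real_complex R) 2) -fmorphV -rmorphM /h /=.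
  congr (_%:C *+ _); have fi := f0 i; have gi := g0 i.
  by field; rewrite !gt_eqF ?addr_gt0.
apply: mulmx1_invmx; apply: (mulmx_invmx_sum _ _ _ _ _ _ _ _ _ uG' _ _ eD).
- by apply: fun_congr_mul_invmx => i; rewrite gt_eqF.
- by apply: fun_congr_mul_invmx => i; rewrite gt_eqF.
Qed.

End FunCongr.

(** * Simultaneous diagonalization of two positive definite matrices by congruence *)

Lemma simultaneous_fun_congr A B : posdefmx A -> posdefmx B ->
  exists G : 'M[R[i]]_n, exists c : 'rV[R]_n,
  [/\ G \in unitmx, forall i, 0 < c 0 i,
     A = fun_congr G c (fun=> 1), B = fun_congr G c id
   & forall v, geomean v A B = fun_congr G c (fun r => r `^ v)].
Proof.
move=> hA hB; have [P [a [uP a0 eA ePow]]] := posdefmx_spectral _ hA.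
pose S := powmx A 2^-1; pose T := powmx A (- 2^-1).
have eST : T *m S = 1%:M.
  rewrite /S /T !ePow mul_fun_congr_unitary //.
  rewrite (eq_fun_congr _ _ _ (fun=> 1)) => [|i].
    by rewrite /fun_congr fun_diag1 mulmx1; apply/mulmx1C/unitarymxP.
  by rewrite powRN mulVf // gt_eqF ?powR_gt0.
have [uT uS] := mulmx1_unit eST.
have eSS : S *m S = A.
  rewrite /S ePow mul_fun_congr_unitary // [RHS]eA; apply: eq_fun_congr => i.
  rewrite -powRD ?(gt_eqF (a0 i)) ?implybT //.
  by rewrite (_ : 2^-1 + 2^-1 = 1 :> R) ?powRr1 ?ltW//; field.
have hS : S^t* = S by rewrite /S ePow trmxC_fun_congr.
have hT : T^t* = T by rewrite /T ePow trmxC_fun_congr.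
have hC : posdefmx (T *m B *m T).
  by have := posdefmx_congr B T uT hB; rewrite hT.
have eG v : geomean v A B = S *m powmx (T *m B *m T) v *m S by [].
(* From here [S] and [T] are just mutually inverse Hermitian matrices with [S *m S = A]. *)
clearbody S T.
have [U [c [uU c0 eC eCpow]]] := posdefmx_spectral _ hC.
have eK f : S *m fun_congr U c f *m S = fun_congr (U *m S) c f.
  by rewrite /fun_congr trmxC_mul hS !mulmxA.
exists (U *m S), c; split; [|by []| | |move=> v].
- by rewrite unitmx_mul uS unitarymx_unit.
- have UU : U^t* *m U = 1%:M by apply/mulmx1C/unitarymxP.
  by rewrite -eK /fun_congr fun_diag1 mulmx1 UU mulmx1 eSS.
- rewrite -eK -eC !mulmxA (mulmx1C eST) mul1mx -mulmxA eST.
  by rewrite mulmx1.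
- by rewrite -eK -eCpow eG.
Qed.

End Hermitian.

Theorem theorem2p3 (R : realType) (n : nat) (A B : 'M[R[i]]_n) (v : R)
    (hA : posdefmx A) (hB : posdefmx B) (hBA : loewner_le B A)
    (hv : 0 <= v <= 1) :
  loewner_le
    ((v * (1 - v) / 2)%:C *:
       ((A - B) *m invmx A *m harmmean A B *m invmx A *m (A - B)))
    (arithmean v A B - geomean v A B)
  /\
  loewner_le
    (arithmean v A B - geomean v A B)
    ((v * (1 - v) / 2)%:C *: ((A - B) *m invmx B *m (A - B))).

Proof.
have [G [c [uG c0 eA eB eG]]] := simultaneous_fun_congr _ _ hA hB.
(* [A - B] is the congruence of [1 - r], and the invertible [G] reflects its positivity to each
   entry of [c]. *)
have c1 i : c 0 i <= 1.
  rewrite -subr_ge0; apply: (possemidef_fun_congr G c (fun r => 1 - r) uG) i.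
  by rewrite -fun_congrB -eA -eB.
have eAB : A - B = fun_congr G c (fun r => 1 - r).
  by rewrite eA eB; exact: (fun_congrB G c (fun=> 1) id).
pose gap r := 1 - v + v * r - r `^ v.
have eM : arithmean v A B - geomean v A B = fun_congr G c gap.
  rewrite eG /arithmean eA eB 2!fun_congrZ fun_congrD fun_congrB.
  by apply: eq_fun_congr => i; rewrite mulr1.
have [v0 v1] := andP hv.
split; rewrite /loewner_le eM eAB.
- have -> : harmmean A B = fun_congr G c (fun r => 2 * 1 * r / (1 + r)).
    by rewrite eA eB; apply: (harmmean_fun_congr G c uG (fun=> 1) id) => // i.
  have N1 i : (fun=> 1 : R) (c 0 i) != 0 by exact: oner_neq0.
  (* The fivefold product collapses in two steps: first the triple ending in the harmonic mean, then
     the triple ending in [A - B]. *)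
  rewrite eA (fun_congr_mul_invmx_mul G c uG _ _ _ N1).
  rewrite (fun_congr_mul_invmx_mul G c uG _ _ _ N1) fun_congrZ fun_congrB.
  apply: fun_congr_possemidef => i /=; rewrite /gap subr_ge0.
  have /andP[+ _] := powR_mean_gap v hv _ (c0 i) (c1 i).
  apply: le_trans.
  have := c0 i; have := c1 i; move: (c 0 i) => r r1 r0.
  have p0 : 0 < 1 + r by rewrite addr_gt0.
  rewrite ler_wpM2l ?divr_ge0 ?mulr_ge0 ?subr_ge0 //.
  (* The harmonic mean contributes the factor [2 * r / (1 + r)], at most 1 since [r <= 1]. *)
  rewrite (_ : _ * (1 - r) = (1 - r) ^+ 2 * (2 * r / (1 + r))); last first.
    by field; rewrite gt_eqF.
  by rewrite ler_piMr ?sqr_ge0 // ler_pdivrMr // mul1r mulr_natl mulr2n lerD2r.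
- have N0 i : id (c 0 i) != 0 by rewrite gt_eqF.
  rewrite eB (fun_congr_mul_invmx_mul G c uG _ _ _ N0) fun_congrZ fun_congrB.
  apply: fun_congr_possemidef => i /=; rewrite /gap subr_ge0.
  have /andP[_] := powR_mean_gap v hv _ (c0 i) (c1 i).
  by rewrite (mulrAC (1 - c 0 i) _ (1 - c 0 i)).
Qed.
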